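(* Let $\mathfrak{C}$ be a 2-category, let $(X^{\bullet},\partial,\tau)$ be a 2-cosemisimplicial object in $\mathfrak{C}$, and let $s,k\geq 1$. Let $\mathcal{C}_{s,k}$ be the category whose objects are the $\partial$-paths from $X^{s-1}$ to $X^{s+k}$ and whose morphisms are the 2-morphisms of $\mathfrak{C}$ obtained by pasting cosemisimplicial coherers $\tau^n_{ij}$ (and their inverses) and identity 2-morphisms of coface maps. Then for any two objects $f,f'$ of $\mathcal{C}_{s,k}$ there is at most one morphism (actually, an isomorphism) in $\mathcal{C}_{s,k}$ from $f$ to $f'$.
   Context: 2-categories are strict. Vertical composition of 2-morphisms is written $\cdot$; composition of 1-morphisms and horizontal composition of 2-morphisms are written $\circ$; $1_f$ is the identity 2-morphism of $f$. A 2-cosemisimplicial object $(X^{\bullet},\partial,\tau)$ in a 2-category $\mathfrak{C}$ consists of objects $X^0,X^1,\ldots$ of $\mathfrak{C}$, 1-morphisms (coface maps) $\partial^i_n:X^{n-1}\to X^n$ for $0\le i\le n$, $n\geq 1$, and 2-isomorphisms (cosemisimplicial coherers) $\tau^n_{ij}:\partial^j_{n+1}\circ\partial^i_n\Rightarrow\partial^i_{n+1}\circ\partial^{j-1}_n$ for $0\leq i<j\leq n+1$, $n\ge 1$, such that for all $n\geq 1$ and $0\leq i<j<k\leq n+2$ $$(1_{\partial^i_{n+2}}\circ\tau^n_{j-1,k-1})\cdot(\tau^{n+1}_{ik}\circ 1_{\partial^{j-1}_n})\cdot(1_{\partial^k_{n+2}}\circ\tau^n_{ij})=(\tau^{n+1}_{ij}\circ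 1_{\partial^{k-2}_n})\cdot(1_{\partial^j_{n+2}}\circ\tau^n_{i,k-1})\cdot(\tau^{n+1}_{jk}\circ 1_{\partial^i_n}).$$ A $\partial$-path from $X^{s-1}$ to $X^{s+k}$ is a formal composite $\partial^{i_k}_{s+k}\circ\cdots\circ\partial^{i_0}_s$ with $0\le i_j\le s+j$, identified with the tuple $(i_0,\ldots,i_k)$. An expanded coherer is a 2-morphism $1_{f'}\circ\tau^n_{ij}\circ 1_f$ with $f,f'$ (possibly empty) $\partial$-paths; it goes from the $\partial$-path $f'\circ\partial^j_{n+1}\circ\partial^i_n\circ f$ to the $\partial$-path $f'\circ\partial^i_{n+1}\circ\partial^{j-1}_n\circ f$. A morphism $\sigma:f\Rightarrow f'$ in $\mathcal{C}_{s,k}$ is a 2-morphism in $\mathfrak{C}$ between the composite 1-morphisms that is a (possibly empty) vertical composite of expanded coherers and inverses of expanded coherers along a sequence of $\partial$-paths leading from $f$ to $f'$. *)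

(* Defs.v *)
From mathcomp Require Import all_boot.

Set Implicit Arguments.
Unset Strict Implicit.
Unset Printing Implicit Defensive.

(* Strict 2-categories.  For objects A and B, the category of 1-morphisms
   A -> B is given by its set of objects [hom A B], its set of arrows
   [cell A B], and source and target maps, so that strict associativity and
   unitality are plain equations, without transport between types of
   2-morphisms.  As composition of functions would be written, [comp1 g f],
   [hcomp b a] and [vcomp b a] are "g o f", "b o a" and "b . a".
   [vcomp b a] is meaningful only if [src b = tgt a]: its values on the other
   pairs are arbitrary and no axiom mentions them. *)
Record twoCategory := TwoCategory {
  ob :> Type;
  hom : ob -> ob -> Type;
  cell : ob -> ob -> Type;
  src : forall A B, cell A B -> hom A B;
  tgt : forall A B, cell A B -> hom A B;
  id1 : forall A, hom A A;
  comp1 : forall A B C, hom B C -> hom A B -> hom A C;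
  id2 : forall A B, hom A B -> cell A B;
  vcomp : forall A B, cell A B -> cell A B -> cell A B;
  hcomp : forall A B C, cell B C -> cell A B -> cell A C;

  comp1A : forall A B C D (h : hom C D) (g : hom B C) (f : hom A B),
    comp1 h (comp1 g f) = comp1 (comp1 h g) f;
  comp1_idl : forall A B (f : hom A B), comp1 (id1 B) f = f;
  comp1_idr : forall A B (f : hom A B), comp1 f (id1 A) = f;

  src_id2 : forall A B (f : hom A B), src (id2 f) = f;
  tgt_id2 : forall A B (f : hom A B), tgt (id2 f) = f;
  src_vcomp : forall A B (b a : cell A B), src b = tgt a ->
    src (vcomp b a) = src a;
  tgt_vcomp : forall A B (b a : cell A B), src b = tgt a ->
    tgt (vcomp b a) = tgt b;
  vcompA : forall A B (c b a : cell A B), src c = tgt b -> src b = tgt a ->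
    vcomp c (vcomp b a) = vcomp (vcomp c b) a;
  vcomp_idl : forall A B (a : cell A B), vcomp (id2 (tgt a)) a = a;
  vcomp_idr : forall A B (a : cell A B), vcomp a (id2 (src a)) = a;

  src_hcomp : forall A B C (b : cell B C) (a : cell A B),
    src (hcomp b a) = comp1 (src b) (src a);
  tgt_hcomp : forall A B C (b : cell B C) (a : cell A B),
    tgt (hcomp b a) = comp1 (tgt b) (tgt a);
  hcompA : forall A B C D (c : cell C D) (b : cell B C) (a : cell A B),
    hcomp c (hcomp b a) = hcomp (hcomp c b) a;
  hcomp_idl : forall A B (a : cell A B), hcomp (id2 (id1 B)) a = a;
  hcomp_idr : forall A B (a : cell A B), hcomp a (id2 (id1 A)) = a;
  hcomp_id2 : forall A B C (g : hom B C) (f : hom A B),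
    hcomp (id2 g) (id2 f) = id2 (comp1 g f);
  interchange : forall A B C (b' b : cell B C) (a' a : cell A B),
    src b' = tgt b -> src a' = tgt a ->
    hcomp (vcomp b' b) (vcomp a' a) = vcomp (hcomp b' a') (hcomp b a)
}.

Arguments id1 {t} A.
Arguments cell : clear implicits.
Arguments hom : clear implicits.

Declare Scope twocat_scope.
Delimit Scope twocat_scope with TC.
Notation "g \o1 f" := (comp1 g f)
  (at level 40, left associativity) : twocat_scope.
Notation "b \oh a" := (hcomp b a)
  (at level 40, left associativity) : twocat_scope.
Notation "b \ov a" := (vcomp b a)
  (at level 50, left associativity) : twocat_scope.
Local Open Scope twocat_scope.

Definition inverse2 (CC : twoCategory) (A B : CC) (a b : cell CC A B) : Prop :=
  [/\ src b = tgt a, tgt b = src a,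
      b \ov a = id2 (src a) & a \ov b = id2 (tgt a)].

(* [coface n i] is the coface map with superscript i and subscript n.+1, from
   X^n to X^(n.+1); it is meaningful for i <= n.+1.  [coherer n i j] is tau
   with superscript n.+1 and subscript ij; it is meaningful for
   i < j <= n.+2.  Outside of these ranges the values are arbitrary and
   unconstrained, and no expanded coherer or path below involves them. *)
Record cosemisimplicial (CC : twoCategory) := Cosemisimplicial {
  obj :> nat -> ob CC;
  coface : forall n, nat -> hom CC (obj n) (obj n.+1);
  coherer : forall n, nat -> nat -> cell CC (obj n) (obj n.+2);
  src_coherer : forall n i j, i < j <= n.+2 ->
    src (coherer n i j) = coface n.+1 j \o1 coface n i;
  tgt_coherer : forall n i j, i < j <= n.+2 ->
    tgt (coherer n i j) = coface n.+1 i \o1 coface n j.-1;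
  coherer_iso : forall n i j, i < j <= n.+2 ->
    exists b, inverse2 (coherer n i j) b;
  coherer_coh : forall n i j k, i < j -> j < k -> k <= n.+3 ->
    (id2 (coface n.+2 i) \oh coherer n j.-1 k.-1)
      \ov (coherer n.+1 i k \oh id2 (coface n j.-1))
      \ov (id2 (coface n.+2 k) \oh coherer n i j)
    = (coherer n.+1 i j \oh id2 (coface n k.-2))
      \ov (id2 (coface n.+2 j) \oh coherer n i k.-1)
      \ov (coherer n.+1 j k \oh id2 (coface n i))
}.

(* Formal composites of coface maps from X^m to X^n, i.e. the tuples
   (i_0, ..., i_(n-m-1)) with i_l <= m + l + 1; [dcons p i] is "coface i
   after p".  ['I_n.+2] is the range of superscripts of the coface maps from
   X^n to X^(n.+1). *)
Inductive dpath (m : nat) : nat -> Type :=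
| dnil : dpath m m
| dcons n : dpath m n -> 'I_n.+2 -> dpath m n.+1.
Arguments dnil {m}.

Fixpoint dcat l m n (f' : dpath m n) (f : dpath l m) : dpath l n :=
  match f' in dpath _ n return dpath l n with
  | dnil => f
  | dcons _ p i => dcons (dcat p f) i
  end.

Section Paths.
Variables (CC : twoCategory) (X : cosemisimplicial CC).

Fixpoint dcomp m n (f : dpath m n) : hom CC (X m) (X n) :=
  match f in dpath _ n return hom CC (X m) (X n) with
  | dnil => id1 (X m)
  | dcons n p i => coface X n i \o1 dcomp p
  end.

Inductive expanded (m r : nat) :
    dpath m r -> dpath m r -> cell CC (X m) (X r) -> Prop :=
| Expanded n (f : dpath m n) (f' : dpath n.+2 r)
    (i : 'I_n.+2) (j : 'I_n.+3) :
    i < j ->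
    expanded (dcat f' (dcons (dcons f i) j))
             (dcat f' (dcons (dcons f (inord j.-1)) (inord i)))
             (id2 (dcomp f') \oh coherer X n i j \oh id2 (dcomp f)).

Inductive pasting (m r : nat) (f : dpath m r) :
    dpath m r -> cell CC (X m) (X r) -> Prop :=
| pasting_id : pasting f f (id2 (dcomp f))
| pasting_step g h a e : pasting f g a -> expanded g h e ->
    pasting f h (e \ov a)
| pasting_inv g h a e e' : pasting f g a -> expanded h g e ->
    inverse2 e e' -> pasting f h (e' \ov a).

Lemma dcomp_cat l m n (f' : dpath m n) (f : dpath l m) :
  dcomp (dcat f' f) = dcomp f' \o1 dcomp f.
Proof.
elim: f' => [|k p IHp i] /=; first by rewrite comp1_idl.
by rewrite IHp comp1A.
Qed.

Lemma expanded_src_tgt m r (f g : dpath m r) e :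
  expanded f g e -> src e = dcomp f /\ tgt e = dcomp g.
Proof.
case=> n p q i j lt_ij; have le_j : j <= n.+2 by rewrite -ltnS ltn_ord.
have lt_j1 : j.-1 < n.+2 by case: (j : nat) lt_ij le_j.
have lt_i : i < n.+3 by rewrite ltnS ltnW.
rewrite !src_hcomp !tgt_hcomp !src_id2 !tgt_id2.
rewrite src_coherer ?tgt_coherer ?lt_ij //.
by rewrite !dcomp_cat /= !inordK // -!comp1A.
Qed.

Lemma pasting_src_tgt m r (f g : dpath m r) a :
  pasting f g a -> src a = dcomp f /\ tgt a = dcomp g.
Proof.
elim=> [|{}g h {}a e _ [sa ta] /expanded_src_tgt[se te]
        |{}g h {}a e e' _ [sa ta] /expanded_src_tgt[se te] [se' te' _ _]].
- by rewrite src_id2 tgt_id2.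
- by rewrite src_vcomp ?tgt_vcomp ?ta.
- by rewrite src_vcomp ?tgt_vcomp ?ta ?se' ?te'.
Qed.

Lemma pasting_comp m r (f g h : dpath m r) a b :
  pasting f g a -> pasting g h b -> pasting f h (b \ov a).
Proof.
move=> fga; have [_ ta] := pasting_src_tgt fga.
elim=> [|{}g' {}h {}b e gb IHb ge|{}g' {}h {}b e e' gb IHb ge ee'].
- by rewrite -ta vcomp_idl.
- have [sb tb] := pasting_src_tgt gb; have [se _] := expanded_src_tgt ge.
  by rewrite -vcompA ?sb ?se //; apply: pasting_step ge.
- have [sb tb] := pasting_src_tgt gb; have [_ te] := expanded_src_tgt ge.
  case: (ee') => se' _ _ _.
  by rewrite -vcompA ?sb ?se' ?te //; apply: pasting_inv ge ee'.
Qed.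

End Paths.

(* The category C_{s,k}: its objects, its morphisms from f to g as a predicate
   on 2-morphisms (by [pasting_src_tgt] such a 2-morphism goes from the
   composite of f to that of g), and its isomorphisms.  Identities and
   composites, those of CC, are given by [pasting_id] and [pasting_comp]. *)
Definition Cob (s k : nat) := dpath s.-1 (s + k).

Definition Cmor (CC : twoCategory) (X : cosemisimplicial CC) (s k : nat)
    (f g : Cob s k) (a : cell CC (X s.-1) (X (s + k))) : Prop :=
  pasting f g a.

Definition Ciso (CC : twoCategory) (X : cosemisimplicial CC) (s k : nat)
    (f g : Cob s k) (a : cell CC (X s.-1) (X (s + k))) : Prop :=
  Cmor f g a /\
  exists b, [/\ Cmor g f b, b \ov a = id2 (dcomp X f)
              & a \ov b = id2 (dcomp X g)].

(* Main.v *)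
Require Import Defs.
From mathcomp Require Import all_boot.

(** Orient the coherers: a pair of adjacent superscripts [i < j] is replaced by
    [j - 1, i].  Each step lowers the sum of the superscripts by one, so this
    rewriting terminates.  Two steps from the same path can be completed to a
    diagram of 2-morphisms that commutes: by the interchange law when they act
    on disjoint pairs, by the coherence axiom when the pairs overlap.  Newman's
    lemma, carried out with 2-morphisms, gives every path [f] a unique normal
    form together with a unique 2-morphism [c_f] to it that is a composite of
    steps.  A pasting [a : f => g] then satisfies [c_g . a = c_f], and [c_g] is
    invertible, so [a] is determined by [f] and [g]. *)

Set Implicit Arguments.
Unset Strict Implicit.
Unset Printing Implicit Defensive.
Local Open Scope twocat_scope.

(** * Whiskering and invertibility in a strict 2-category *)

Section TwoCategory.
Variable CC : twoCategory.

Lemma hcomp_idl_vcomp (A B C : CC) (g : hom CC B C) (b a : cell CC A B) :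
  src b = tgt a -> id2 g \oh (b \ov a) = (id2 g \oh b) \ov (id2 g \oh a).
Proof.
move=> ba; rewrite -Defs.interchange ?src_id2 ?tgt_id2 //.
by have := vcomp_idl (id2 g); rewrite tgt_id2 => ->.
Qed.

Lemma hcomp_idr_vcomp (A B C : CC) (f : hom CC A B) (b a : cell CC B C) :
  src b = tgt a -> (b \ov a) \oh id2 f = (b \oh id2 f) \ov (a \oh id2 f).
Proof.
move=> ba; rewrite -Defs.interchange ?src_id2 ?tgt_id2 //.
by have := vcomp_idl (id2 f); rewrite tgt_id2 => ->.
Qed.

(** By interchange, both sides are the horizontal composite of [b] and [a]. *)
Lemma hcomp_whisker_swap (A B C : CC) (b : cell CC B C) (a : cell CC A B) :
  (b \oh id2 (tgt a)) \ov (id2 (src b) \oh a)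
  = (id2 (tgt b) \oh a) \ov (b \oh id2 (src a)).
Proof.
rewrite -!Defs.interchange ?src_id2 ?tgt_id2 //.
by rewrite !vcomp_idl !vcomp_idr.
Qed.

Lemma inverse2_sym (A B : CC) (a b : cell CC A B) :
  inverse2 a b -> inverse2 b a.
Proof. by case=> sb tb ba ab; split; rewrite // ?sb ?tb. Qed.

Lemma inverse2_id2 (A B : CC) (f : hom CC A B) : inverse2 (id2 f) (id2 f).
Proof.
by have := vcomp_idl (id2 f); rewrite /inverse2 src_id2 tgt_id2.
Qed.

Lemma inverse2_hcomp (A B C : CC) (b b' : cell CC B C) (a a' : cell CC A B) :
  inverse2 b b' -> inverse2 a a' -> inverse2 (b \oh a) (b' \oh a').
Proof.
move=> [sb tb b'b bb'] [sa ta a'a aa']; split.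
- by rewrite src_hcomp tgt_hcomp sb sa.
- by rewrite src_hcomp tgt_hcomp tb ta.
- by rewrite -Defs.interchange // b'b a'a hcomp_id2 src_hcomp.
- by rewrite -Defs.interchange // bb' aa' hcomp_id2 tgt_hcomp.
Qed.

Lemma inverse2_vcomp (A B : CC) (b b' a a' : cell CC A B) :
  src b = tgt a -> inverse2 b b' -> inverse2 a a' ->
  inverse2 (b \ov a) (a' \ov b').
Proof.
move=> ba [sb tb b'b bb'] [sa ta a'a aa'].
have a'b' : src a' = tgt b' by rewrite sa tb.
split.
- by rewrite src_vcomp // tgt_vcomp // sb.
- by rewrite src_vcomp // tgt_vcomp // ta.
- rewrite src_vcomp // vcompA ?src_vcomp //.
  by rewrite -(vcompA (c := a')) // b'b ba -sa vcomp_idr a'a.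
- rewrite tgt_vcomp // vcompA ?src_vcomp ?tgt_vcomp //.
  by rewrite -(vcompA (c := b)) // aa' -ba vcomp_idr bb'.
Qed.

End TwoCategory.

(** * Oriented coherers as a terminating rewriting relation on paths *)

Section Coherence.
Variables (CC : twoCategory) (X : cosemisimplicial CC) (m : nat).

(** A coherer acting on the last two cofaces. The superscripts exchange ordinal types with different
    bounds, so the new ones are pinned down by their values rather than by casts. *)
Definition top_step n (p : dpath m n) :
    'I_n.+2 -> dpath m n.+1 -> cell CC (X m) (X n.+1) -> Prop :=
  match p in dpath _ n
    return 'I_n.+2 -> dpath m n.+1 -> cell CC (X m) (X n.+1) -> Prop with
  | dnil => fun _ _ _ => False
  | dcons n p i => fun j g e => exists (i' : 'I_n.+2) (j' : 'I_n.+3),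
      [/\ i < j, i' = j.-1 :> nat, j' = i :> nat,
          g = dcons (dcons p i') j' & e = coherer X n i j \oh id2 (dcomp X p)]
  end.

(* The relation [expanded], by recursion on the source: this avoids inverting
   an inductive family that is indexed by paths. *)
Fixpoint step n (f : dpath m n) : dpath m n -> cell CC (X m) (X n) -> Prop :=
  match f in dpath _ n
    return dpath m n -> cell CC (X m) (X n) -> Prop with
  | dnil => fun _ _ => False
  | dcons n p i => fun g e => top_step p i g e \/
      exists q e', [/\ step p q e', g = dcons q i
                     & e = id2 (coface X n i) \oh e']
  end.

Lemma expanded_step n (f g : dpath m n) e : expanded f g e -> step f g e.
Proof.
case=> l p q i j lt_ij; have le_j : j <= l.+2 by rewrite -ltnS ltn_ord.
have lt_j1 : j.-1 < l.+2 by case: (j : nat) lt_ij le_j.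
have lt_i : i < l.+3 by rewrite ltnS ltnW.
elim: q => [|r q IHq k] /=.
  left; exists (inord j.-1), (inord i); split; rewrite ?inordK //.
  by rewrite hcomp_idl.
right; exists (dcat q (dcons (dcons p (inord j.-1)) (inord i))).
by eexists; split; [exact: IHq | | rewrite -hcomp_id2 !hcompA].
Qed.

Lemma step_src_tgt n (f g : dpath m n) e :
  step f g e -> src e = dcomp X f /\ tgt e = dcomp X g.
Proof.
elim: f g e => [//|{}n p IHp j] g e /= [|[q [e' [/IHp[se te] -> ->]]]]; last first.
  by rewrite src_hcomp tgt_hcomp src_id2 tgt_id2 se te.
case: p j g e {IHp} => [//|{}n p i] j g e /= [i' [j' [lt_ij vi vj -> ->]]] /=.
have ltij : i < j <= n.+2 by rewrite lt_ij -ltnS ltn_ord.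
rewrite src_hcomp tgt_hcomp src_id2 tgt_id2 src_coherer // tgt_coherer //.
by rewrite vi vj !comp1A.
Qed.

Lemma step_inverse n (f g : dpath m n) e :
  step f g e -> exists e', inverse2 e e'.
Proof.
elim: f g e => [//|{}n p IHp j] g e /= [|[q [e' [/IHp[d ed] _ ->]]]]; last first.
  by exists (id2 (coface X n j) \oh d); apply: inverse2_hcomp ed; apply: inverse2_id2.
case: p j g e {IHp} => [//|{}n p i] j g e /= [i' [j' [lt_ij _ _ _ ->]]].
have ltij : i < j <= n.+2 by rewrite lt_ij -ltnS ltn_ord.
have [d cd] := coherer_iso X ltij.
by exists (d \oh id2 (dcomp X p)); apply: inverse2_hcomp => //; apply: inverse2_id2.
Qed.

Fixpoint weight n (f : dpath m n) : nat :=
  match f with dnil => 0 | dcons _ p i => weight p + i end.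

Lemma step_weight n (f g : dpath m n) e : step f g e -> weight g < weight f.
Proof.
elim: f g e => [//|{}n p IHp j] g e /= [|[q [e' [/IHp lt_qp -> _]]]]; last first.
  by rewrite /= ltn_add2r.
case: p j g e {IHp} => [//|{}n p i] j g e /= [i' [j' [lt_ij vi vj -> _]]] /=.
rewrite vi vj -!addnA ltn_add2l [i + j]addnC ltn_add2r.
by rewrite prednK // (leq_ltn_trans _ lt_ij).
Qed.

Definition normal n (f : dpath m n) : Prop := forall g e, ~ step f g e.

(** A step applies exactly where a superscript is smaller than the next one, so normal paths are the
    weakly decreasing tuples. Once the shorter path is normal, only the last two superscripts have
    to be compared. *)
Lemma step_or_normal n (f : dpath m n) :
  (exists g e, step f g e) \/ normal f.
Proof.
elim: f => [|{}n p IHp j]; first by right=> g e [].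
case: IHp => [[q [e st]]|norm_p].
  by left; exists (dcons q j); eexists; right; exists q, e.
case: p j norm_p => [|{}n p i] j norm_p.
  by right=> g e [[]|[q [e' [[]]]]].
have [lt_ij|le_ji] := ltnP i j.
  have le_j : j <= n.+2 by rewrite -ltnS ltn_ord.
  have lt_j1 : j.-1 < n.+2 by case: (j : nat) lt_ij le_j.
  left; exists (dcons (dcons p (Ordinal lt_j1)) (widen_ord (leqnSn _) i)).
  by eexists; left; exists (Ordinal lt_j1), (widen_ord (leqnSn _) i).
right=> g e [[i' [j' []]]|[q [e' [st _ _]]]]; last exact: norm_p st.
by rewrite ltnNge le_ji.
Qed.

(** Steps are added at the source, so that case analysis exposes the first step, where two
    reductions of one path diverge. *)
Inductive red n (f : dpath m n) :
    dpath m n -> cell CC (X m) (X n) -> Prop :=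
| red_refl : red f f (id2 (dcomp X f))
| red_step g h e a : step f g e -> red g h a -> red f h (a \ov e).

Lemma red_src_tgt n (f g : dpath m n) a :
  red f g a -> src a = dcomp X f /\ tgt a = dcomp X g.
Proof.
elim=> [{}f|{}f {}g h e {}a /step_src_tgt[se te] _ [sa ta]].
  by rewrite src_id2 tgt_id2.
by rewrite src_vcomp ?tgt_vcomp ?sa ?te.
Qed.

Lemma red_inverse n (f g : dpath m n) a :
  red f g a -> exists a', inverse2 a a'.
Proof.
elim=> [{}f|{}f {}g h e {}a st rd [a' aa']].
  by exists (id2 (dcomp X f)); apply: inverse2_id2.
have [e' ee'] := step_inverse st; exists (e' \ov a').
apply: inverse2_vcomp => //.
by have [-> _] := red_src_tgt rd; have [_ ->] := step_src_tgt st.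
Qed.

Lemma red1 n (f g : dpath m n) e : step f g e -> red f g e.
Proof.
move=> st; have [_ te] := step_src_tgt st.
by rewrite -(vcomp_idl e) te; apply: red_step st _; apply: red_refl.
Qed.

Lemma red_trans n (f g h : dpath m n) a b :
  red f g a -> red g h b -> red f h (b \ov a).
Proof.
move=> rd; elim: rd b => [{}f|{}f {}g g' e {}a st rd IH] b gh.
  by have [<- _] := red_src_tgt gh; rewrite vcomp_idr.
have [sb _] := red_src_tgt gh; have [sa ta] := red_src_tgt rd.
have [_ te] := step_src_tgt st.
rewrite vcompA ?sb ?sa //.
exact: red_step st (IH _ gh).
Qed.

Lemma red_dcons n (f g : dpath m n) (i : 'I_n.+2) a :
  red f g a -> red (dcons f i) (dcons g i) (id2 (coface X n i) \oh a).
Proof.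
elim=> [{}f|{}f {}g h e {}a st rd IH].
  by rewrite hcomp_id2; apply: red_refl.
have [sa _] := red_src_tgt rd; have [_ te] := step_src_tgt st.
rewrite hcomp_idl_vcomp ?sa //; apply: red_step IH.
by right; exists g, e.
Qed.

(** * Local confluence, with commuting diagrams of 2-morphisms *)

Definition joinable n (g1 g2 : dpath m n) (e1 e2 : cell CC (X m) (X n)) :=
  exists h a1 a2, [/\ red g1 h a1, red g2 h a2 & a1 \ov e1 = a2 \ov e2].

Lemma joinable_sym n (g1 g2 : dpath m n) e1 e2 :
  joinable g1 g2 e1 e2 -> joinable g2 g1 e2 e1.
Proof. by move=> [h [a1 [a2 [r1 r2 eq12]]]]; exists h, a2, a1. Qed.

(** The steps share no coface, so each can still be applied after the other. *)
Lemma joinable_disjoint n (p q : dpath m n) (i : 'I_n.+2) (j : 'I_n.+3) g1 e1 e :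
  top_step (dcons p i) j g1 e1 -> step p q e ->
  joinable g1 (dcons (dcons q i) j) e1
    (id2 (coface X n.+1 j) \oh (id2 (coface X n i) \oh e)).
Proof.
move=> /= [i' [j' [lt_ij vi vj -> ->]]] st; have [se te] := step_src_tgt st.
have ltij : i < j <= n.+2 by rewrite lt_ij -ltnS ltn_ord.
exists (dcons (dcons q i') j').
exists (id2 (coface X n.+1 j') \oh (id2 (coface X n i') \oh e)).
exists (coherer X n i j \oh id2 (dcomp X q)); split.
- by do 2 apply: red_dcons; apply: red1.
- by apply: red1; left; exists i', j'.
(* The composites of two cofaces are read as source and target of the coherer, which gives the shape
   of [hcomp_whisker_swap]. *)
- rewrite !hcompA !hcomp_id2 vi vj -(src_coherer X ltij) -(tgt_coherer X ltij).
  by rewrite -se -te hcomp_whisker_swap.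
Qed.

Lemma coherer_coh_whisker n (f : hom CC (X m) (X n)) i j k :
  i < j -> j < k -> k <= n.+3 ->
  let w := id2 f in
  (id2 (coface X n.+2 i) \oh coherer X n j.-1 k.-1 \oh w)
    \ov (coherer X n.+1 i k \oh id2 (coface X n j.-1) \oh w)
    \ov (id2 (coface X n.+2 k) \oh coherer X n i j \oh w)
  = (coherer X n.+1 i j \oh id2 (coface X n k.-2) \oh w)
    \ov (id2 (coface X n.+2 j) \oh coherer X n i k.-1 \oh w)
    \ov (coherer X n.+1 j k \oh id2 (coface X n i) \oh w).
Proof.
move=> lt_ij lt_jk le_k w.
have := congr1 (fun c => c \oh w) (coherer_coh X lt_ij lt_jk le_k).
(* Both [j] and [k] are positive; as successors they let the predecessors compute. The facts that
   follow put the six coherers of the axiom in range, so that whiskering distributes over the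
   vertical composites. *)
case: k lt_jk le_k => // k lt_jk le_k; case: j lt_ij lt_jk => // j lt_ij lt_jk /=.
have [lt_ik lt_jn] := (leq_trans lt_ij lt_jk, leq_trans lt_jk le_k).
have Hij : i < j.+1 <= n.+2 by rewrite lt_ij.
have Hij' : i < j.+1 <= n.+3 by rewrite lt_ij ltnW.
have Hik : i < k <= n.+2 by rewrite lt_ik.
have Hik' : i < k.+1 <= n.+3 by rewrite ltnS ltnW.
have Hjk : j < k <= n.+2 by apply/andP.
have Hjk' : j.+1 < k.+1 <= n.+3 by rewrite lt_jk.
have E := (src_coherer X Hij, tgt_coherer X Hij, src_coherer X Hij', tgt_coherer X Hij',
  src_coherer X Hik, tgt_coherer X Hik, src_coherer X Hik', tgt_coherer X Hik',
  src_coherer X Hjk, tgt_coherer X Hjk, src_coherer X Hjk', tgt_coherer X Hjk').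
have sE A B C (b : cell CC B C) (a : cell CC A B) := (src_hcomp b a, tgt_hcomp b a).
rewrite !hcomp_idr_vcomp // ?src_vcomp ?tgt_vcomp //;
  by rewrite !sE !src_id2 !tgt_id2 !E !comp1A.
Qed.

(** The critical pair: superscripts (i, j, k) with i < j < k. Starting on the right, the path goes
    through (i, k-1, j) and (k-2, i, j); starting on the left, through (j-1, i, k) and (j-1, k-1,
    i). Both end at (k-2, j-1, i), and this hexagon is the coherence axiom. *)
Lemma joinable_overlap n (p : dpath m n)
    (i : 'I_n.+2) (j : 'I_n.+3) (k : 'I_n.+4) g1 e1 g2 e2 :
  top_step (dcons (dcons p i) j) k g1 e1 -> top_step (dcons p i) j g2 e2 ->
  joinable g1 (dcons g2 k) e1 (id2 (coface X n.+2 k) \oh e2).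
Proof.
move=> /= [a [b [lt_jk va vb -> ->]]] [c [d [lt_ij vc vd -> ->]]].
have le_k : k <= n.+3 by rewrite -ltnS ltn_ord.
have gt1k : 1 < k := leq_ltn_trans (leq_ltn_trans (leq0n i) lt_ij) lt_jk.
have lt_k2 : k.-2 < n.+2 by case: (k : nat) gt1k le_k => [|[|l]].
have ltSi : i < n.+4 := leq_trans (ltn_ord i) (leq_addl 2 _).
have ltSj : j.-1 < n.+3 := leq_ltn_trans (leq_pred _) (ltn_ord j).
pose x := Ordinal lt_k2; pose y := Ordinal ltSj; pose z := Ordinal ltSi.
have lt_ia : i < a.
  by rewrite va; case: (k : nat) lt_jk => // l; apply: leq_trans lt_ij.
have lt_ca : c < a.
  by rewrite va vc; case: (k : nat) (j : nat) lt_jk lt_ij => [|k'] [|j'].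
have lt_dk : d < k by rewrite vd (ltn_trans lt_ij).
exists (dcons (dcons (dcons p x) y) z).
(* [t1] then [u1] complete the branch of [e1], the right side of the axiom; [t2] then [u2] complete
   that of [e2], the left side. *)
pose wp := id2 (dcomp X p).
pose t1 := id2 (coface X n.+2 b) \oh (coherer X n i a \oh wp).
pose u1 := coherer X n.+1 i b \oh id2 (dcomp X (dcons p x)).
pose t2 := coherer X n.+1 d k \oh id2 (dcomp X (dcons p c)).
pose u2 := id2 (coface X n.+2 z) \oh (coherer X n c a \oh wp).
have st1 : step (dcons (dcons (dcons p i) a) b) (dcons (dcons (dcons p x) d) b) t1.
  right; exists (dcons (dcons p x) d), (coherer X n i a \oh wp); split=> //.
  by left; exists x, d; split=> //=; rewrite va.
have su1 : step (dcons (dcons (dcons p x) d) b) (dcons (dcons (dcons p x) y) z) u1.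
  left; exists y, z; split=> //=; rewrite ?vb ?vd //.
  by rewrite /u1 vb.
have st2 : step (dcons (dcons (dcons p c) d) k) (dcons (dcons (dcons p c) a) z) t2.
  by left; exists a, z; split=> //=; rewrite vd.
have su2 : step (dcons (dcons (dcons p c) a) z) (dcons (dcons (dcons p x) y) z) u2.
  right; exists (dcons (dcons p x) y), (coherer X n c a \oh wp); split=> //.
  by left; exists x, y; split=> //=; rewrite ?va ?vc.
exists (u1 \ov t1), (u2 \ov t2); split.
- exact: red_trans (red1 st1) (red1 su1).
- exact: red_trans (red1 st2) (red1 su2).
rewrite /u1 /t1 /u2 /t2 /wp /= -!hcomp_id2 !hcompA va vb vc vd -/wp.
exact/esym/coherer_coh_whisker.
Qed.

(** Two steps at the last pair coincide, since their results have equal superscripts; two steps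
    below the last coface are joined by induction and whiskered with it. *)
Lemma step_joinable n (f g1 g2 : dpath m n) e1 e2 :
  step f g1 e1 -> step f g2 e2 -> joinable g1 g2 e1 e2.
Proof.
elim: f g1 g2 e1 e2 => [//|{}n p IHp k] g1 g2 e1 e2.
(* The mixed case: the lower step either shares the middle coface with the top one (overlap) or
   avoids both of its cofaces (disjoint). *)
have top_below q e3 g e : top_step p k g e -> step p q e3 ->
    joinable g (dcons q k) e (id2 (coface X n k) \oh e3).
  case: p k {IHp g1 g2 e1 e2} q e3 g e => [//|{}n p j] k q e3 g e top_g.
  case=> [top_q|[q' [e' [st -> ->]]]]; last exact: joinable_disjoint top_g st.
  case: p j k q e3 g e top_q top_g => [//|{}n p i] j k q e3 g e top_q top_g.
  exact: joinable_overlap top_q.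
case=> [top1|[q1 [d1 [st1 -> ->]]]] [top2|[q2 [d2 [st2 -> ->]]]].
- case: p k g1 g2 e1 e2 {IHp top_below} top1 top2 => [//|{}n p j] k g1 g2 e1 e2.
  move=> [a [b [lt_jk va vb -> ->]]] [c [d [_ vc vd -> ->]]].
  have <- : a = c by apply: val_inj; rewrite /= va vc.
  have <- : b = d by apply: val_inj; rewrite /= vb vd.
  by do 3 eexists; split; [exact: red_refl | exact: red_refl | ].
- exact: top_below.
- exact/joinable_sym/top_below.
have [h [a1 [a2 [r1 r2 eq12]]]] := IHp _ _ _ _ st1 st2.
have [[sa1 _] [sa2 _]] := (red_src_tgt r1, red_src_tgt r2).
have [[_ t1] [_ t2]] := (step_src_tgt st1, step_src_tgt st2).
exists (dcons h k), (id2 (coface X n k) \oh a1), (id2 (coface X n k) \oh a2).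
split; try exact: red_dcons.
by rewrite -!hcomp_idl_vcomp ?eq12 ?sa1 ?sa2.
Qed.

(** * Unique normal forms, and uniqueness and invertibility of pastings *)

Lemma red_normal n (f : dpath m n) : exists h a, red f h a /\ normal h.
Proof.
have [w] := ubnP (weight f); elim: w f => // w IHw f lt_f.
have [[g [e st]]|] := step_or_normal f; last first.
  by exists f, (id2 (dcomp X f)); split=> //; apply: red_refl.
have [|h [a [rd nh]]] := IHw g; first exact: leq_trans (step_weight st) _.
by exists h, (a \ov e); split=> //; apply: red_step st rd.
Qed.

(** Newman's argument by induction on the weight. The join of the two first steps is reduced further
    to a normal [h']; the induction hypothesis at [g1] and at [g2] identifies [h1] and [h2] with
    [h'], along with the 2-morphisms. *)
Lemma red_normal_unique n (f h1 h2 : dpath m n) a1 a2 :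
  red f h1 a1 -> red f h2 a2 -> normal h1 -> normal h2 -> h1 = h2 /\ a1 = a2.
Proof.
have [w] := ubnP (weight f); elim: w f h1 h2 a1 a2 => // w IHw f h1 h2 a1 a2 lt_f.
case=> [|g1 {}h1 e1 {}a1 st1 r1]; case=> [|g2 {}h2 e2 {}a2 st2 r2] // n1 n2.
- by case: (n1 _ _ st2).
- by case: (n2 _ _ st1).
have [h [b1 [b2 [j1 j2 eqj]]]] := step_joinable st1 st2.
have [h' [d [rh nh]]] := red_normal h.
have lt1 : weight g1 < w := leq_trans (step_weight st1) lt_f.
have [-> ->] := IHw _ _ _ _ _ lt1 r1 (red_trans j1 rh) n1 nh.
have lt2 : weight g2 < w := leq_trans (step_weight st2) lt_f.
have [-> ->] := IHw _ _ _ _ _ lt2 r2 (red_trans j2 rh) n2 nh.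
have [[sb1 tb1] [sb2 tb2]] := (red_src_tgt j1, red_src_tgt j2).
have [[_ t1] [_ t2]] := (step_src_tgt st1, step_src_tgt st2).
have [sd _] := red_src_tgt rh.
by rewrite -!vcompA ?eqj ?sd ?sb1 ?sb2.
Qed.

Lemma pasting_red_normal n (f g h : dpath m n) a c :
  pasting f g a -> red f h c -> normal h ->
  exists2 d, red g h d & d \ov a = c.
Proof.
move=> pa rc nh; elim: pa => [|{}g g' {}a e pa [d rd <-] /expanded_step st
                             |{}g g' {}a e e' pa [d rd <-] /expanded_step st ee'].
- by exists c => //; have [<- _] := red_src_tgt rc; rewrite vcomp_idr.
- have [_ ta] := pasting_src_tgt pa; have [se te] := step_src_tgt st.
  (* Along a forward step, uniqueness for [g] factors [d] as a reduction [d'] of [g'] after [e]. *)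
  have [h' [d' [rd' nh']]] := red_normal g'.
  have [eqh eqd] := red_normal_unique rd (red_step st rd') nh nh'.
  have [sd' _] := red_src_tgt rd'.
  exists d'; first by rewrite eqh.
  by rewrite eqd vcompA ?sd' ?te // se ta.
- have [_ ta] := pasting_src_tgt pa; have [se te] := step_src_tgt st.
  have [sd _] := red_src_tgt rd; have [se' te' _ ee] := ee'.
  (* Along an inverse step, [e] runs from [g'] to [g] and is put in front of [d]; it then cancels
     against [e']. *)
  exists (d \ov e); first exact: red_step st rd.
  rewrite -vcompA ?src_vcomp ?tgt_vcomp ?te' ?se' ?sd ?te ?ta //.
  by rewrite (vcompA (c := e)) ?se' ?te' ?te ?ta // ee te -ta vcomp_idl.
Qed.

Lemma pasting_unique n (f g : dpath m n) (a b : cell CC (X m) (X n)) :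
  pasting f g a -> pasting f g b -> a = b.
Proof.
move=> pa pb; have [h [c [rc nh]]] := red_normal f.
have [d rd da] := pasting_red_normal pa rc nh.
have [d2 rd2 db] := pasting_red_normal pb rc nh.
have [_ eqd] := red_normal_unique rd2 rd nh nh; rewrite eqd in db.
have [d' [sd' _ d'd _]] := red_inverse rd; have [sd _] := red_src_tgt rd.
have [[_ ta] [_ tb]] := (pasting_src_tgt pa, pasting_src_tgt pb).
(* Left cancellation of [d]: the identity of the target is expanded into [d' \ov d]. *)
rewrite -(vcomp_idl a) -(vcomp_idl b) ta tb -sd -d'd.
by rewrite -!vcompA ?sd' ?sd ?ta ?tb // da db.
Qed.

(** The pasting is run backwards: an expanded coherer is undone by its inverse, and an inverse by
    the coherer itself. *)
Lemma pasting_inverse n (f g : dpath m n) (a : cell CC (X m) (X n)) :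
  pasting f g a -> exists2 b, pasting g f b & inverse2 a b.
Proof.
elim=> [|{}g h {}a e pa [b pb ab] st|{}g h {}a e e' pa [b pb ab] st ee'].
- by exists (id2 (dcomp X f)); [exact: pasting_id | exact: inverse2_id2].
- have [e' ee'] := step_inverse (expanded_step st).
  exists (b \ov e').
    apply: pasting_comp pb; have [_ te] := expanded_src_tgt st.
    (* Composing [e'] with an identity exhibits it as a pasting of length one. *)
    have [se' _ _ _] := ee'; rewrite -(vcomp_idr e') se' te.
    by apply: pasting_inv st ee'; apply: pasting_id.
  apply: inverse2_vcomp => //.
  by have [-> _] := expanded_src_tgt st; have [_ ->] := pasting_src_tgt pa.
- exists (b \ov e).
    apply: pasting_comp pb; have [se _] := expanded_src_tgt st.
    by rewrite -(vcomp_idr e) se; apply: pasting_step st; apply: pasting_id.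
  apply: inverse2_vcomp => //; last exact: inverse2_sym.
  have [-> _ _ _] := ee'; have [_ ->] := expanded_src_tgt st.
  by have [_ ->] := pasting_src_tgt pa.
Qed.

End Coherence.

Theorem theorem4p2 (CC : twoCategory) (X : cosemisimplicial CC) (s k : nat)
    (hs : 1 <= s) (hk : 1 <= k) (f f' : Cob s k) :
  (forall a b : cell CC (X s.-1) (X (s + k)),
     Cmor f f' a -> Cmor f f' b -> a = b) /\
  (forall a : cell CC (X s.-1) (X (s + k)),
     Cmor f f' a -> Ciso f f' a).
Proof.
split=> [a b|a pa]; first exact: pasting_unique.
have [b pb [sb tb ba ab]] := pasting_inverse pa.
have [sa ta] := pasting_src_tgt pa.
by split=> //; exists b; rewrite -sa -ta.
Qed.
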